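(* Let $(F_k)_{k\ge 0}$ be the Fibonacci sequence, defined by $F_0=0$, $F_1=1$ and $F_k=F_{k-1}+F_{k-2}$ for $k\ge 2$. The only solutions of the Diophantine equation \[ F_n - F_m = 2^a \] in nonnegative integers $m<n$ and $a$ are \[ (n,m,a)\in\{(1,0,0),(2,0,0),(3,0,1),(6,0,3),(3,1,0),(4,1,1),(5,1,2),(3,2,0), (4,3,0),(4,2,1),(5,2,2),(9,3,5),(5,4,1),(7,5,3),(8,5,4),(8,7,3)\}. \] *)

(* Defs.v *)
From mathcomp Require Import all_boot.

(* [fibonacci] in Stdlib's [Zgcd_alt] is shifted by one: it starts 1, 1. *)
Fixpoint fib (k : nat) : nat :=
  match k with
  | 0 => 0
  | 1 => 1
  | (k''.+1 as k').+1 => fib k' + fib k''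
  end.

(* Main.v *)
Require Import Defs.
From mathcomp Require Import all_boot all_order all_algebra.

(** A congruence argument suffices, without bounds on linear forms in logarithms:
    [F_n = F_m + 2 ^ (6 + a)] has no solution modulo [2 ^ 6 * 3 * 5 * 7 * 241].
    Modulo that number the Fibonacci sequence has period 480 and [2 ^ (6 + a)] has
    period 24 in [a], so there are finitely many residues [(n, m, a)] to exclude;
    lifting them through a chain of divisors of 480 and 24, and discarding at each
    step those incompatible with one modulus, keeps the search tiny.  For exponents below 6,
    [F_(n-2) <= F_n - F_m < 34 = F_9] leaves only [n <= 10]. *)

Lemma nth_traject_mod (T : Type) (f : T -> T) (x y : T) (p k : nat) :
  0 < p -> iter p f x = x -> nth y (traject f x p) (k %% p) = iter k f x.
Proof.
move=> p_gt0 fpx; rewrite (set_nth_default x) ?size_traject ?ltn_pmod //.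
rewrite nth_traject ?ltn_pmod // {2}(divn_eq k p) addnC iterD; congr iter.
by elim: (k %/ p) => //= d IHd; rewrite mulSn iterD -IHd.
Qed.

(** Consecutive Fibonacci residues as a pair: the recurrence becomes one map to iterate, on numbers
    kept small. *)
Definition fib_step (M : nat) (x : nat * nat) : nat * nat := (x.2, (x.1 + x.2) %% M).

Lemma iter_fib_step M k :
  iter k (fib_step M) (0, 1 %% M) = (fib k %% M, fib k.+1 %% M).
Proof.
elim: k => [|k IHk]; first by rewrite mod0n.
by rewrite iterS IHk /fib_step /= modnDm addnC.
Qed.

Definition double_step (M x : nat) : nat := (x + x) %% M.

Lemma iter_double_step M c k :
  iter k (double_step M) (c %% M) = (c * 2 ^ k) %% M.
Proof.
elim: k => [|k IHk]; first by rewrite muln1.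
by rewrite iterS IHk /double_step modnDm addnn -muln2 -mulnA -expnSr.
Qed.

Lemma leq_fib : {homo fib : m n / m <= n}.
Proof.
apply: homo_leq => [//|? ? ?|[|n]]; [exact: leq_trans | by [] | exact: leq_addr].
Qed.

Definition residue_lifts (q L i : nat) : seq nat := [seq k * L + i | k <- iota 0 q].

Lemma mem_residue_lifts q L n :
  0 < q -> 0 < L -> n %% (q * L) \in residue_lifts q L (n %% L).
Proof.
move=> q_gt0 L_gt0; apply/mapP; exists ((n %/ L) %% q).
  by rewrite mem_iota ltn_pmod.
by rewrite modn_divl {1}(divn_eq (n %% _) L) modn_dvdm ?dvdn_mull.
Qed.

Definition triple_lifts (q r L A : nat) (s : nat * nat * nat) : seq (nat * nat * nat) :=
  [seq (nm, a) | nm <- [seq (n, m) | n <- residue_lifts q L s.1.1,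
                                     m <- residue_lifts q L s.1.2],
                 a <- residue_lifts r A s.2].

(** [S] lists the possible residues of [n] and [m] modulo [L] and of [a] modulo
    [A].  A stage [(q, r, M)] refines [L] to [q * L] and [A] to [r * A], which must
    be periods modulo [M] of the two sequences, and tests the equation modulo [M]. *)
Fixpoint sieve_empty (L A : nat) (S : seq (nat * nat * nat))
    (stages : seq (nat * nat * nat)) : bool :=
  if stages is (q, r, M) :: stages' then
    let F := traject (fib_step M) (0, 1 %% M) (q * L) in
    let P := traject (double_step M) (64 %% M) (r * A) in
    [&& 0 < q, 0 < r,
        iter (q * L) (fib_step M) (0, 1 %% M) == (0, 1 %% M),
        iter (r * A) (double_step M) (64 %% M) == 64 %% M
      & sieve_empty (q * L) (r * A)
          [seq s <- flatten [seq triple_lifts q r L A s | s <- S]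
             | (nth (0, 0) F s.1.1).1
               == ((nth (0, 0) F s.1.2).1 + nth 0 P s.2) %% M]
          stages']
  else nilp S.

(** The residues of a solution pass every test, so starting in [S] they would survive into the
    final, empty list. *)
Lemma sieve_empty_sound (n m a : nat) stages L A S :
  0 < L -> 0 < A -> fib n = fib m + 64 * 2 ^ a ->
  sieve_empty L A S stages -> (n %% L, m %% L, a %% A) \notin S.
Proof.
move=> + + E; elim: stages L A S => [|[[q r] M] stages IH] L A S L_gt0 A_gt0 /=.
  by move/nilP->.
case/and5P=> q_gt0 r_gt0 /eqP FL /eqP PA empty.
have qL_gt0 : 0 < q * L by rewrite muln_gt0 q_gt0.
have rA_gt0 : 0 < r * A by rewrite muln_gt0 r_gt0.
have := IH _ _ _ qL_gt0 rA_gt0 empty.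
apply: contra => inS.
rewrite mem_filter /= !nth_traject_mod //.
rewrite !iter_fib_step iter_double_step modnDm E eqxx /=.
apply/flatten_mapP; exists (n %% L, m %% L, a %% A) => //.
by do !apply: allpairs_f; apply: mem_residue_lifts.
Qed.

Lemma fib_neq_add_pow2 n m a : 6 <= a -> fib n <> fib m + 2 ^ a.
Proof.
move=> /subnKC <-; rewrite expnD => E.
(* Modulo a divisor of 64 the term [64 * 2 ^ a] vanishes, so those stages need not refine [a]. *)
have empty : sieve_empty 1 1 [:: (0, 0, 0)]
    [:: (3, 1, 2); (2, 1, 4); (2, 1, 8); (2, 1, 16); (1, 2, 3); (2, 1, 32);
        (1, 3, 7); (2, 1, 64); (5, 2, 5); (1, 2, 241)] by vm_compute.
have := sieve_empty_sound _ _ _ _ 1 1 _ isT isT E empty.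
by rewrite !modn1 mem_head.
Qed.

Lemma fib_add_pow2_lt n m a :
  m < n -> fib n = fib m + 2 ^ a -> a < 6 /\ n < 11.
Proof.
move=> lt_mn E.
have lt_a6 : a < 6 by rewrite ltnNge; apply/negP => /fib_neq_add_pow2/(_ E).
split=> //; rewrite ltnNge; apply/negP; case: n lt_mn E => [|[|n]] // lt_mn E n_ge.
(* Now [n] is the original index minus 2, and [m <= n.+1] gives [fib m + fib n <= fib n.+2]. *)
have : fib n <= 2 ^ 5.
  rewrite (leq_trans _ (leq_pexp2l _ (_ : a <= 5))) // -(leq_add2l (fib m)) -E.
  by rewrite [fib n.+2]/(fib n.+1 + fib n) leq_add2r leq_fib.
by apply/negP; rewrite -ltnNge; apply: (@leq_trans (fib 9)) => //; apply: leq_fib.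
Qed.

Import GRing.Theory.
Local Open Scope ring_scope.

Theorem theorem3 (n m a : nat) :
  ((m < n)%N /\ (fib n)%:Z - (fib m)%:Z = 2%:Z ^+ a) <->
  (n, m, a) \in
    [:: (1, 0, 0); (2, 0, 0); (3, 0, 1); (6, 0, 3); (3, 1, 0); (4, 1, 1);
        (5, 1, 2); (3, 2, 0); (4, 3, 0); (4, 2, 1); (5, 2, 2); (9, 3, 5);
        (5, 4, 1); (7, 5, 3); (8, 5, 4); (8, 7, 3)]%N.
Proof.
set sols := (X in _ \in X).
have natE : (fib n)%:Z - (fib m)%:Z = 2%:Z ^+ a <-> fib n = (fib m + 2 ^ a)%N.
  rewrite -[2%:Z]natz -natrX natz; split=> [/eqP|->].
    by rewrite subr_eq addrC -PoszD => /eqP[].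
  by rewrite PoszD addrC addKr.
split=> [[lt_mn /natE E]|].
  have [lt_a6 lt_n11] := fib_add_pow2_lt _ _ _ lt_mn E.
  have checked : all (fun n => all (fun m => all (fun a =>
      (fib n == fib m + 2 ^ a)%N ==> ((n, m, a) \in sols))
      (iota 0 6)) (iota 0 n)) (iota 0 11) by vm_compute.
  have/allP/(_ n) := checked; rewrite mem_iota => /(_ lt_n11).
  move=> /allP/(_ m); rewrite mem_iota => /(_ lt_mn).
  by move=> /allP/(_ a); rewrite mem_iota E eqxx; apply.
have checked : all (fun s => (s.1.2 < s.1.1)%N &&
  (fib s.1.1 == fib s.1.2 + 2 ^ s.2)%N) sols by vm_compute.
by move/(allP checked) => /andP[lt_mn /eqP E]; split=> //; apply/natE.
Qed.
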